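(* The signature adjunction $(+)_S:\mathcal{S}_s\rightleftarrows\mathcal{S}_f:(-)_S$ (with $(+)_S$ left adjoint, unit $\eta_S$ and counit $\varepsilon_S$) lifts, via the forgetful functors $U_s:\mathcal{L}_s\to\mathcal{S}_s$ and $U_f:\mathcal{L}_f\to\mathcal{S}_f$, to a logic adjunction $(+)_L:\mathcal{L}_s\rightleftarrows\mathcal{L}_f:(-)_L$ (with $(+)_L$ left adjoint, unit $\eta_L$ and counit $\varepsilon_L$), i.e.: (1) $U_f\circ(+)_L=(+)_S\circ U_s$; (2) $U_s\circ(-)_L=(-)_S\circ U_f$; (3) $U_s\eta_L=\eta_S U_s$; (4) $U_f\varepsilon_L=\varepsilon_S U_f$. Moreover, the following relations hold: (5) $(+)_L\circ\bot_s=\bot_f\circ(+)_S$; (6) $(+)_L\circ\top_s=\top_f\circ(+)_S$; (7) $(-)_L\circ\bot_f=\bot_s\circ(-)_S$; (8) $(-)_L\circ\top_f\leq\top_s\circ(-)_S$.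
   Context: Signatures. Fix an enumerable set of variables $X=\{x_0,x_1,\dots\}$. A signature is a sequence of pairwise disjoint sets $\Sigma=(\Sigma_n)_{n\in\mathbb{N}}$. $F(\Sigma)$ is the set of formulas over $\Sigma$ with variables in $X$; $F(\Sigma)[n]=\{\varphi\in F(\Sigma):\mathrm{var}(\varphi)=\{x_0,\dots,x_{n-1}\}\}$; $T(\Sigma):=(F(\Sigma)[n])_{n}$ is again a signature; $(j_\Sigma)_n:\Sigma_n\to F(\Sigma)[n]$, $c_n\mapsto c_n(x_0,\dots,x_{n-1})$. $\mathcal{S}_s$: signatures with strict morphisms $f=(f_n:\Sigma_n\to\Sigma'_n)_n$, composed componentwise; the extension $\hat f:F(\Sigma)\to F(\Sigma')$ fixes variables and satisfies $\hat f(c_n(\psi_0,\dots,\psi_{n-1}))=f_n(c_n)(\hat f(\psi_0),\dots,\hat f(\psi_{n-1}))$. $\mathcal{S}_f$: signatures with flexible morphisms $f:\Sigma\to\Sigma'$, given by strict morphisms $f^\sharp:\Sigma\to T(\Sigma')$ (write $g^\flat$ for the flexible morphism with $(g^\flat)^\sharp=g$); the extension $\check f:F(\Sigma)\to F(\Sigma')$ fixes variables and satisfies $\check f(c_n(\psi_0,\dots,\psi_{n-1}))=f^\sharp_n(c_n)[x_0\mid\check f(\psi_0),\dots,x_{n-1}\mid\check f(\psi_{n-1})]$; it restricts to $\check f\restriction_n:F(\Sigma)[n]\to F(\Sigma')[n]$. Composition $(f'\bullet f)^\sharp_n=\check{f'}\restriction_n\circ f^\sharp_n$, identity $(id_\Sigma)^\sharp=j_\Sigma$.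 $(+)_S:\mathcal{S}_s\to\mathcal{S}_f$ is the identity on objects and sends $f:\Sigma\to\Sigma'$ to $(j_{\Sigma'}\circ f)^\flat$; $(-)_S:\mathcal{S}_f\to\mathcal{S}_s$ sends $\Sigma$ to $T(\Sigma)$ and $h$ to $(\check h\restriction_n)_n$. $(\eta_S)_\Sigma=j_\Sigma:\Sigma\to T(\Sigma)$, and $(\varepsilon_S)_\Sigma:T(\Sigma)\to\Sigma$ in $\mathcal{S}_f$ is given by $((\varepsilon_S)_\Sigma)^\sharp_n=id_{F(\Sigma)[n]}$. Logics. A logic is a pair $l=(\Sigma,\vdash)$ with $\Sigma$ a signature and $\vdash$ a structural finitary Tarskian consequence relation on $F(\Sigma)$, i.e. $\mathrm{Cons}(\Gamma)=\{\varphi:\Gamma\vdash\varphi\}$ is a closure operator that is finitary and satisfies $\widetilde\sigma(\mathrm{Cons}(\Gamma))\subseteq\mathrm{Cons}(\widetilde\sigma(\Gamma))$ for each substitution $\sigma:X\to F(\Sigma)$ with homomorphic extension $\widetilde\sigma$. $\mathrm{Cons}_\Sigma$ is the complete lattice of all such relations on $\Sigma$, ordered by $\vdash_0\leq\vdash_1$ iff $\Gamma\vdash_0\varphi$ implies $\Gamma\vdash_1\varphi$ for all $\Gamma,\varphi$. $\mathcal{L}_s$ (resp. $\mathcal{L}_f$): objects are logics; a morphism $(\Sigma,\vdash)\to(\Sigma',\vdash')$ is a morphism $f:\Sigma\to\Sigma'$ of $\mathcal{S}_s$ (resp. $\mathcal{S}_f$) such that $\Gamma\vdash\psi$ implies $\hat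 f[\Gamma]\vdash'\hat f(\psi)$ (resp. $\check f[\Gamma]\vdash'\check f(\psi)$); composition and identities as in $\mathcal{S}_s$ (resp. $\mathcal{S}_f$). $U_s$, $U_f$ are the functors forgetting the consequence relation. $\bot_s:\mathcal{S}_s\to\mathcal{L}_s$ and $\bot_f:\mathcal{S}_f\to\mathcal{L}_f$ (left adjoints of $U_s$, $U_f$) send $\Sigma$ to $\Sigma$ with the least element of $\mathrm{Cons}_\Sigma$; $\top_s:\mathcal{S}_s\to\mathcal{L}_s$ and $\top_f:\mathcal{S}_f\to\mathcal{L}_f$ (right adjoints) send $\Sigma$ to $\Sigma$ with the greatest element of $\mathrm{Cons}_\Sigma$; all act as the identity on underlying morphisms. In (8), $\leq$ means that for each signature the two logics have the same underlying signature and the consequence relation on the left is $\leq$ that on the right. *)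

(* Defs.v *)
From mathcomp Require Import all_boot.
From mathcomp Require Import boolp classical_sets functions cardinality.

Set Implicit Arguments.
Unset Strict Implicit.
Unset Printing Implicit Defensive.

Local Open Scope classical_set_scope.

(** * Categories, functors, natural transformations, adjunctions *)

Record category := Category {
  obj :> Type;
  hom : obj -> obj -> Type;
  idm : forall x, hom x x;
  compm : forall x y z, hom y z -> hom x y -> hom x z;
  comp_assoc : forall x y z t (h : hom z t) (g : hom y z) (f : hom x y),
    compm h (compm g f) = compm (compm h g) f;
  comp_idl : forall x y (f : hom x y), compm (idm y) f = f;
  comp_idr : forall x y (f : hom x y), compm f (idm x) = f }.

Arguments idm {_} _.
Arguments compm {_ _ _ _} _ _.

Record functor (C D : category) := Functor {
  fobj :> C -> D;
  fmap : forall x y : C, hom x y -> hom (fobj x) (fobj y);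
  fmap_id : forall x : C, fmap (idm x) = idm (fobj x);
  fmap_comp : forall (x y z : C) (g : hom y z) (f : hom x y),
    fmap (compm g f) = compm (fmap g) (fmap f) }.

Arguments fmap {_ _} _ {_ _} _.

Definition functor_id (C : category) : functor C C :=
  @Functor C C id (fun _ _ f => f) (fun _ => erefl) (fun _ _ _ _ _ => erefl).

Section FunctorComp.
Variables (C D E : category) (G : functor D E) (F : functor C D).

Let gf_map (x y : C) (f : hom x y) : hom (G (F x)) (G (F y)) :=
  fmap G (fmap F f).

Fact functor_comp_id (x : C) : gf_map (idm x) = idm (G (F x)).
Proof. by rewrite /gf_map !fmap_id. Qed.

Fact functor_comp_comp (x y z : C) (g : hom y z) (f : hom x y) :
  gf_map (compm g f) = compm (gf_map g) (gf_map f).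
Proof. by rewrite /gf_map !fmap_comp. Qed.

Definition functor_comp : functor C E :=
  @Functor C E (fun x => G (F x)) gf_map functor_comp_id functor_comp_comp.
End FunctorComp.

Notation "G \oF F" := (functor_comp G F) (at level 50, left associativity).

Record nattrans (C D : category) (F G : functor C D) := NatTrans {
  component :> forall x : C, hom (F x) (G x);
  naturality : forall (x y : C) (f : hom x y),
    compm (component y) (fmap F f) = compm (fmap G f) (component x) }.

Record adjunction (C D : category) := Adjunction {
  adj_left : functor C D;
  adj_right : functor D C;
  adj_unit : nattrans (functor_id C) (adj_right \oF adj_left);
  adj_counit : nattrans (adj_left \oF adj_right) (functor_id D);
  triangle_left : forall x : C,
    compm (adj_counit (adj_left x)) (fmap adj_left (adj_unit x)) =
    idm (adj_left x);
  triangle_right : forall y : D,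
    compm (fmap adj_right (adj_counit y)) (adj_unit (adj_right y)) =
    idm (adj_right y) }.

(* A morphism together with its endpoints: [arrow f = arrow g] is equality of
   morphisms whose endpoints are only provably (not definitionally) equal. *)
Definition arrow (C : category) (x y : C) (f : hom x y) :
  {p : C * C & hom p.1 p.2} := existT (fun p => hom p.1 p.2) (x, y) f.

(** * Signatures and formulas *)

(* The sets of connectives of distinct arities are distinct types, hence
   pairwise disjoint. *)
Definition signature := nat -> Type.

Inductive form (S : signature) : Type :=
| Var of nat
| App n of S n & ('I_n -> form S).
Arguments Var {S} _.
Arguments App {S n} _ _.

Fixpoint vars (S : signature) (phi : form S) : set nat :=
  match phi with
  | Var i => [set i]
  | App _ _ a => \bigcup_k vars (a k)
  end.

Definition terms (S : signature) : signature :=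
  fun n => {phi : form S | vars phi = `I_n}.

Lemma terms_inj (S : signature) n (t u : terms S n) : sval t = sval u -> t = u.
Proof. by case: t u => [t tP] [u uP] /= tu; exact: eq_exist. Qed.

Fixpoint subst (S : signature) (s : nat -> form S) (phi : form S) : form S :=
  match phi with
  | Var i => s i
  | App _ c a => App c (fun k => subst s (a k))
  end.

(* The simultaneous substitution x_0 | a_0, ..., x_{n-1} | a_{n-1}; the other
   variables are left fixed. *)
Definition fill (S : signature) n (a : 'I_n -> form S) : nat -> form S :=
  fun i => oapp a (Var i) (insub i).

Lemma fill_ord (S : signature) n (a : 'I_n -> form S) (k : 'I_n) :
  fill a k = a k.
Proof. by rewrite /fill valK. Qed.

Lemma vars_subst (S : signature) (s : nat -> form S) (phi : form S) :
  vars (subst s phi) = \bigcup_(i in vars phi) vars (s i).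
Proof.
elim: phi => [i|n c a IH] /=; first by rewrite bigcup_set1.
rewrite predeqE => x; split.
  move=> [k _]; rewrite IH => -[i ik ix].
  by exists i => //; exists k.
by move=> [i [k _ ik] ix]; exists k => //; rewrite IH; exists i.
Qed.

Lemma eq_subst (S : signature) (s t : nat -> form S) (phi : form S) :
  {in vars phi, s =1 t} -> subst s phi = subst t phi.
Proof.
elim: phi => [i|n c a IH] /= st; first by apply: st; rewrite inE.
congr App; apply: funext => k; apply: IH => i; rewrite inE => ik.
by apply: st; rewrite inE; exists k.
Qed.

Lemma subst_Var (S : signature) (phi : form S) : subst Var phi = phi.
Proof. by elim: phi => //= n c a IH; congr App; apply: funext. Qed.

Lemma subst_subst (S : signature) (s t : nat -> form S) (phi : form S) :
  subst t (subst s phi) = subst (fun i => subst t (s i)) phi.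
Proof. by elim: phi => //= n c a IH; congr App; apply: funext. Qed.

Lemma subst_fill (S : signature) n (phi : terms S n) (a : 'I_n -> form S)
    (s : nat -> form S) :
  subst s (subst (fill a) (sval phi)) =
  subst (fill (fun k => subst s (a k))) (sval phi).
Proof.
rewrite subst_subst; apply: eq_subst => i; rewrite inE (svalP phi) /= => lin.
by rewrite -[i]/(val (Ordinal lin)) !fill_ord.
Qed.

Lemma vars_fill (S : signature) n (phi : terms S n) (a : 'I_n -> form S) :
  vars (subst (fill a) (sval phi)) = \bigcup_k vars (a k).
Proof.
rewrite vars_subst (svalP phi) predeqE => x; split.
  move=> [i /= lin]; rewrite -[i]/(val (Ordinal lin)) fill_ord.
  by exists (Ordinal lin).
by move=> [k _ kx]; exists (val k) => /=; rewrite ?fill_ord.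
Qed.

Fact vars_generic (S : signature) n (c : S n) :
  vars (App c (fun k : 'I_n => Var k)) = `I_n.
Proof.
rewrite predeqE => i; split=> [[k _ /= ->] //|/= lin].
by exists (Ordinal lin).
Qed.

(** * Strict and flexible morphisms of signatures *)

Definition strict (S S' : signature) := forall n, S n -> S' n.

(* A flexible morphism is represented by its strict morphism [f^#]. *)
Definition flexible (S S' : signature) := strict S (terms S').

Definition generic (S : signature) : strict S (terms S) :=
  fun n c => exist _ (App c (fun k : 'I_n => Var k)) (vars_generic c).

Lemma strict_ext (S S' : signature) (f g : strict S S') :
  (forall n c, f n c = g n c) -> f = g.
Proof.
move=> fg; apply: functional_extensionality_dep => n; apply: funext => c.
exact: fg.
Qed.

Fixpoint hat (S S' : signature) (f : strict S S') (phi : form S) : form S' :=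
  match phi with
  | Var i => Var i
  | App n c a => App (f n c) (fun k => hat f (a k))
  end.

Fixpoint check (S S' : signature) (f : flexible S S') (phi : form S) :
    form S' :=
  match phi with
  | Var i => Var i
  | App n c a => subst (fill (fun k => check f (a k))) (sval (f n c))
  end.

Lemma hat_id (S : signature) (phi : form S) :
  hat (fun n (c : S n) => c) phi = phi.
Proof. by elim: phi => //= n c a IH; congr App; apply: funext. Qed.

Lemma hat_comp (S S' S'' : signature) (g : strict S' S'') (f : strict S S')
    (phi : form S) :
  hat (fun n c => g n (f n c)) phi = hat g (hat f phi).
Proof. by elim: phi => //= n c a IH; congr App; apply: funext. Qed.

Lemma check_generic (S S' : signature) (f : strict S S') (phi : form S) :
  check (fun n c => generic (f n c)) phi = hat f phi.
Proof.
elim: phi => //= n c a IH; congr App; apply: funext => k.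
by rewrite fill_ord.
Qed.

Lemma check_id (S : signature) (phi : form S) : check (@generic S) phi = phi.
Proof. by rewrite -[RHS]hat_id -check_generic. Qed.

Lemma vars_check (S S' : signature) (f : flexible S S') (phi : form S) :
  vars (check f phi) = vars phi.
Proof.
by elim: phi => //= n c a IH; rewrite vars_fill; apply: eq_bigcupr => k _.
Qed.

Lemma check_subst (S S' : signature) (f : flexible S S') (s : nat -> form S)
    (phi : form S) :
  check f (subst s phi) = subst (fun i => check f (s i)) (check f phi).
Proof.
elim: phi => //= n c a IH; rewrite subst_fill; congr (subst (fill _) _).
exact: funext.
Qed.

Fact vars_check_restr (S S' : signature) (f : flexible S S') n
  (t : terms S n) : vars (check f (sval t)) = `I_n.
Proof. by rewrite vars_check (svalP t). Qed.

Definition check_restr (S S' : signature) (f : flexible S S') :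
    strict (terms S) (terms S') :=
  fun n t => exist _ (check f (sval t)) (vars_check_restr f t).

Definition flexible_comp (S S' S'' : signature) (g : flexible S' S'')
    (f : flexible S S') : flexible S S'' :=
  fun n c => check_restr g (f n c).

Lemma check_comp (S S' S'' : signature) (g : flexible S' S'')
    (f : flexible S S') (phi : form S) :
  check (flexible_comp g f) phi = check g (check f phi).
Proof.
elim: phi => //= n c a IH; rewrite check_subst; apply: eq_subst => i.
rewrite inE vars_check (svalP (f n c)) /= => lin.
by rewrite -[i]/(val (Ordinal lin)) !fill_ord.
Qed.

Definition Ss : category :=
  @Category signature strict
    (fun S n c => c) (fun S S' S'' g f n c => g n (f n c))
    (fun _ _ _ _ _ _ _ => erefl) (fun _ _ _ => erefl) (fun _ _ _ => erefl).

Fact flexible_compA (S S' S'' S3 : signature) (h : flexible S'' S3)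
    (g : flexible S' S'') (f : flexible S S') :
  flexible_comp h (flexible_comp g f) = flexible_comp (flexible_comp h g) f.
Proof.
by apply: strict_ext => n c; apply: terms_inj => /=; rewrite check_comp.
Qed.

Fact flexible_comp1m (S S' : signature) (f : flexible S S') :
  flexible_comp (@generic S') f = f.
Proof.
by apply: strict_ext => n c; apply: terms_inj => /=; rewrite check_id.
Qed.

Fact flexible_compm1 (S S' : signature) (f : flexible S S') :
  flexible_comp f (@generic S) = f.
Proof.
apply: strict_ext => n c; apply: terms_inj => /=.
rewrite -[RHS]subst_Var; apply: eq_subst => i.
rewrite inE (svalP (f n c)) /= => lin.
by rewrite -[i]/(val (Ordinal lin)) fill_ord.
Qed.

Definition Sf : category :=
  @Category signature flexible generic flexible_comp
    flexible_compA flexible_comp1m flexible_compm1.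

(** * The signature adjunction *)

Definition plus_map (S S' : signature) (f : strict S S') : flexible S S' :=
  fun n c => generic (f n c).

Fact plus_map_comp (S S' S'' : signature) (g : strict S' S'')
    (f : strict S S') :
  plus_map (fun n c => g n (f n c)) = flexible_comp (plus_map g) (plus_map f).
Proof.
apply: strict_ext => n c; apply: terms_inj => /=.
by congr App; apply: funext => k; rewrite fill_ord.
Qed.

Definition plus_S : functor Ss Sf :=
  @Functor Ss Sf (fun S => S) plus_map (fun _ => erefl) plus_map_comp.

Fact check_restr_id (S : signature) :
  check_restr (@generic S) = (fun n t => t).
Proof. exact: flexible_comp1m (fun n t => t). Qed.

Fact check_restr_comp (S S' S'' : signature) (g : flexible S' S'')
    (f : flexible S S') :
  check_restr (flexible_comp g f) =
  (fun n t => check_restr g (check_restr f t)).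
Proof.
by apply: strict_ext => n t; apply: terms_inj; rewrite /= check_comp.
Qed.

Definition minus_S : functor Sf Ss :=
  @Functor Sf Ss terms check_restr check_restr_id check_restr_comp.

Fact eta_S_natural (S S' : signature) (f : strict S S') :
  (fun n c => generic (f n c)) =
  (fun n c => check_restr (plus_map f) (generic c)).
Proof. exact: plus_map_comp f (fun n c => c). Qed.

Definition eta_S : nattrans (functor_id Ss) (minus_S \oF plus_S) :=
  @NatTrans Ss Ss (functor_id Ss) (minus_S \oF plus_S) generic eta_S_natural.

Definition eval (S : signature) : flexible (terms S) S := fun n t => t.

Fact eval_generic (S S' : signature) (f : flexible S S') n c :
  check (@eval S') (sval (generic (f n c))) = sval (f n c).
Proof. exact: (congr1 (fun h => sval (h n c)) (flexible_compm1 f)). Qed.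

Fact eps_S_natural (S S' : signature) (f : flexible S S') :
  flexible_comp (@eval S') (plus_map (check_restr f)) =
  flexible_comp f (@eval S).
Proof.
apply: strict_ext => n t; apply: terms_inj.
exact: (eval_generic (flexible_comp f (@eval S))).
Qed.

Definition eps_S : nattrans (plus_S \oF minus_S) (functor_id Sf) :=
  @NatTrans Sf Sf (plus_S \oF minus_S) (functor_id Sf) eval eps_S_natural.

Fact sig_triangle_left (S : signature) :
  flexible_comp (@eval S) (plus_map (@generic S)) = @generic S.
Proof.
apply: strict_ext => n c; apply: terms_inj.
exact: (eval_generic (@generic S)).
Qed.

Fact sig_triangle_right (S : signature) :
  (fun n (t : terms S n) => check_restr (@eval S) (generic t)) =
  (fun n t => t).
Proof.
by apply: strict_ext => n c; apply: terms_inj; exact: (eval_generic (@eval S)).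
Qed.

Definition adj_S : adjunction Ss Sf :=
  @Adjunction Ss Sf plus_S minus_S eta_S eps_S
    sig_triangle_left sig_triangle_right.

(** * Logics *)

Record conseq (S : signature) := Conseq {
  Cons : set (form S) -> set (form S);
  Cons_ext : forall G, G `<=` Cons G;
  Cons_mono : forall G D, G `<=` D -> Cons G `<=` Cons D;
  Cons_idem : forall G, Cons (Cons G) `<=` Cons G;
  Cons_finitary : forall G phi, Cons G phi ->
    exists D, [/\ finite_set D, D `<=` G & Cons D phi];
  Cons_structural : forall (s : nat -> form S) G,
    subst s @` Cons G `<=` Cons (subst s @` G) }.

Definition conseq_le (S : signature) (c d : conseq S) : Prop :=
  forall G phi, Cons c G phi -> Cons d G phi.

Section BotTop.
Variable S : signature.

Fact bot_finitary (G : set (form S)) phi : G phi ->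
  exists D, [/\ finite_set D, D `<=` G & D phi].
Proof.
move=> Gphi; exists [set phi]; split; [exact: finite_set1| |by []].
by move=> _ ->.
Qed.

Definition conseq_bot : conseq S :=
  @Conseq S (fun G => G) (fun _ _ => id) (fun _ _ => id) (fun _ _ => id)
    bot_finitary (fun _ _ _ => id).

Lemma conseq_botP (c : conseq S) : conseq_le conseq_bot c.
Proof. by move=> G phi; exact: Cons_ext. Qed.

Fact top_finitary (G : set (form S)) (phi : form S) : setT phi ->
  exists D, [/\ finite_set D, D `<=` G & setT phi].
Proof. by move=> _; exists set0; split; [exact: finite_set0| |]. Qed.

Definition conseq_top : conseq S :=
  @Conseq S (fun _ => setT) (fun _ _ _ => I) (fun _ _ _ _ => id)
    (fun _ _ => id) top_finitary (fun _ _ _ _ => I).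

Lemma conseq_topP (c : conseq S) : conseq_le c conseq_top.
Proof. by []. Qed.
End BotTop.

Record logic := Logic { sig_of : signature; conseq_of : conseq sig_of }.

Variant logic_le : logic -> logic -> Prop :=
| LogicLe (S : signature) (c d : conseq S) of conseq_le c d :
    logic_le (Logic c) (Logic d).

Definition preserves (l l' : logic)
    (F : form (sig_of l) -> form (sig_of l')) : Prop :=
  forall G psi, Cons (conseq_of l) G psi ->
    Cons (conseq_of l') (F @` G) (F psi).

Lemma preserves_id (l : logic) (F : form (sig_of l) -> form (sig_of l)) :
  (forall phi, F phi = phi) -> preserves F.
Proof. by move=> /funext -> G psi; rewrite image_id. Qed.

Lemma preserves_comp (l l' l'' : logic)
    (F' : form (sig_of l') -> form (sig_of l''))
    (F : form (sig_of l) -> form (sig_of l'))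
    (H : form (sig_of l) -> form (sig_of l'')) :
  (forall phi, H phi = F' (F phi)) -> preserves F' -> preserves F ->
  preserves H.
Proof.
by move=> /funext -> F'P FP G psi /FP /F'P; rewrite image_comp.
Qed.

Definition Ls_hom (l l' : logic) :=
  {f : strict (sig_of l) (sig_of l') | preserves (hat f)}.

Definition Ls_id (l : logic) : Ls_hom l l :=
  exist (fun f => preserves (hat f)) (idm (sig_of l : Ss))
    (preserves_id (@hat_id _)).

Definition Ls_comp (l l' l'' : logic) (g : Ls_hom l' l'') (f : Ls_hom l l') :
    Ls_hom l l'' :=
  exist (fun f => preserves (hat f)) (@compm Ss _ _ _ (sval g) (sval f))
    (preserves_comp (hat_comp (sval g) (sval f)) (svalP g) (svalP f)).

Definition Lf_hom (l l' : logic) :=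
  {f : flexible (sig_of l) (sig_of l') | preserves (check f)}.

Definition Lf_id (l : logic) : Lf_hom l l :=
  exist (fun f => preserves (check f)) (idm (sig_of l : Sf))
    (preserves_id (@check_id _)).

Definition Lf_comp (l l' l'' : logic) (g : Lf_hom l' l'') (f : Lf_hom l l') :
    Lf_hom l l'' :=
  exist (fun f => preserves (check f)) (@compm Sf _ _ _ (sval g) (sval f))
    (preserves_comp (check_comp (sval g) (sval f)) (svalP g) (svalP f)).

Definition Ls : category.
Proof.
apply: (@Category logic Ls_hom Ls_id Ls_comp).
- by move=> l1 l2 l3 l4 h g f; exact/eq_exist/(@comp_assoc Ss).
- by move=> l l' [f fP]; exact/eq_exist/(@comp_idl Ss).
- by move=> l l' [f fP]; exact/eq_exist/(@comp_idr Ss).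
Defined.

Definition Lf : category.
Proof.
apply: (@Category logic Lf_hom Lf_id Lf_comp).
- by move=> l1 l2 l3 l4 h g f; exact/eq_exist/(@comp_assoc Sf).
- by move=> l l' [f fP]; exact/eq_exist/(@comp_idl Sf).
- by move=> l l' [f fP]; exact/eq_exist/(@comp_idr Sf).
Defined.

Definition U_s : functor Ls Ss :=
  @Functor Ls Ss sig_of (fun _ _ f => sval f)
    (fun _ => erefl) (fun _ _ _ _ _ => erefl).

Definition U_f : functor Lf Sf :=
  @Functor Lf Sf sig_of (fun _ _ f => sval f)
    (fun _ => erefl) (fun _ _ _ _ _ => erefl).

Lemma preserves_bot (S S' : signature) (F : form S -> form S') :
  @preserves (Logic (conseq_bot S)) (Logic (conseq_bot S')) F.
Proof. by move=> G psi Gpsi; exists psi. Qed.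

Lemma preserves_top (S S' : signature) (F : form S -> form S') :
  @preserves (Logic (conseq_top S)) (Logic (conseq_top S')) F.
Proof. by []. Qed.

Definition bot_s : functor Ss Ls.
Proof.
apply: (@Functor Ss Ls (fun S => Logic (conseq_bot S))
  (fun S S' f => exist _ f (preserves_bot (hat f)))).
- by move=> S; exact: eq_exist.
- by move=> S S' S'' g f; exact: eq_exist.
Defined.

Definition bot_f : functor Sf Lf.
Proof.
apply: (@Functor Sf Lf (fun S => Logic (conseq_bot S))
  (fun S S' f => exist _ f (preserves_bot (check f)))).
- by move=> S; exact: eq_exist.
- by move=> S S' S'' g f; exact: eq_exist.
Defined.

Definition top_s : functor Ss Ls.
Proof.
apply: (@Functor Ss Ls (fun S => Logic (conseq_top S))
  (fun S S' f => exist _ f (preserves_top (hat f)))).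
- by move=> S; exact: eq_exist.
- by move=> S S' S'' g f; exact: eq_exist.
Defined.

Definition top_f : functor Sf Lf.
Proof.
apply: (@Functor Sf Lf (fun S => Logic (conseq_top S))
  (fun S S' f => exist _ f (preserves_top (check f)))).
- by move=> S; exact: eq_exist.
- by move=> S S' S'' g f; exact: eq_exist.
Defined.

(* Main.v *)
(** If [(+)_L] kept the consequence relation, [(-)_L] would have to be the
    inverse image along [check eval : F(T Sigma) -> F(Sigma)], which is not
    injective (it identifies [d(e(x_0))] with [(d e)(x_0)]), and (7) would fail.
    Here [(+)_L] enlarges the consequence relation instead.  Let [trace T] range
    over a family of maps [F(Sigma) -> F(Sigma)] that are natural in strict
    morphisms and compatible with substitutions.  [(+)_L] sends [|-] to the
    relation generated by [trace T Gamma |- trace T phi] for all [T] and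
    [Gamma |- phi]; [(-)_L] sends [|-'] to the finitary part of "for all [T],
    [check eval (trace T Gamma) |-' check eval (trace T phi)]".  Naturality of
    the traces makes these functors adjoint over the signature adjunction.
    Relation (7) holds because the maps [check eval o trace T] separate a
    formula from any finite set of other formulas. *)
Require Import Defs.
From mathcomp Require Import all_boot.
From mathcomp Require Import boolp classical_sets functions cardinality.
From mathcomp Require Import zify.
(* Restores [Cons], shadowed by the list constructor of seq. *)
Import Defs.

Set Implicit Arguments.
Unset Strict Implicit.
Unset Printing Implicit Defensive.

Local Open Scope classical_set_scope.

(** * Heights of formulas and plugging at a variable *)

Lemma App_inj {S : signature} {n} {c d : S n} {a b : 'I_n -> form S} :
  App c a = App d b -> c = d /\ a = b.
Proof.
move=> [] cd ab.
have inj := Eqdep_dec.inj_pair2_eq_dec _ PeanoNat.Nat.eq_dec.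
by split; [exact: inj cd|exact: inj ab].
Qed.

Lemma subst_inj (S : signature) (s t : nat -> form S) (phi : form S) :
  subst s phi = subst t phi -> forall i, vars phi i -> s i = t i.
Proof.
elim: phi => [j /= st _ -> //|n c a IH /= /App_inj[_ st] i [k _ ik]].
by apply: (IH k) ik; exact: (congr1 (@^~ k) st).
Qed.

Fixpoint height (S : signature) (phi : form S) : nat :=
  if phi is App n _ a then (\max_(k < n) height (a k)).+1 else 0.

Lemma height_arg (S : signature) n (c : S n) (a : 'I_n -> form S) k :
  height (a k) < height (App c a).
Proof. exact: (leq_bigmax (F := fun k => height (a k))). Qed.

Definition plug (S : signature) (x : nat) (t A : form S) : form S :=
  subst (fun i => if i == x then A else Var i) t.

(** Length of the longest branch ending at an occurrence of [x]; also 0 if [x] is absent. *)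
Fixpoint depth (S : signature) (x : nat) (phi : form S) : nat :=
  if phi is App n _ a then \max_(k < n | `[< vars (a k) x >]) (depth x (a k)).+1
  else 0.

Lemma depth_arg (S : signature) x n (c : S n) (a : 'I_n -> form S) k :
  vars (a k) x -> depth x (a k) < depth x (App c a).
Proof.
move=> xk.
exact: (leq_bigmax_cond (F := fun k => (depth x (a k)).+1) k (asboolT xk)).
Qed.

Section Plug.
Variables (S : signature) (x : nat).
Implicit Types t u A B : form S.

Lemma plug_notin t A : ~ vars t x -> plug x t A = t.
Proof.
move=> xt; rewrite -[RHS]subst_Var; apply: eq_subst => i; rewrite inE => it.
by case: eqP => // ix; rewrite ix in it.
Qed.

Lemma plug_inj t A B : vars t x -> plug x t A = plug x t B -> A = B.
Proof. by move=> xt /subst_inj/(_ x xt); rewrite eqxx. Qed.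

Lemma plug_App n (c : S n) (a : 'I_n -> form S) A :
  plug x (App c a) A = App c (fun k => plug x (a k) A).
Proof. by []. Qed.

(** A branch of [plug x t A] is a branch of [t], or one ending at [x] continued by a branch of
    [A]. *)
Lemma height_plug_le t A :
  height (plug x t A) <= maxn (height t) (depth x t + height A).
Proof.
elim: t => [i|n c a IH]; first by rewrite /plug /=; case: eqP => //= _; lia.
have H k : height (plug x (a k) A) <
    maxn (height (App c a)) (depth x (App c a) + height A).
  have ha := height_arg c a k.
  have [xk|xk] := pselect (vars (a k) x); last by rewrite plug_notin //; lia.
  by have := depth_arg c xk; have := IH k; lia.
have m_gt0 : 0 < maxn (height (App c a)) (depth x (App c a) + height A).
  by rewrite leq_max.
rewrite plug_App /= -/(height (App c a)) -/(depth x (App c a)).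
rewrite -(prednK m_gt0) ltnS; apply/bigmax_leqP => k _.
by rewrite -ltnS (prednK m_gt0).
Qed.

Lemma height_plug_ge t A :
  vars t x -> depth x t + height A <= height (plug x t A).
Proof.
elim: t => [i /= ->|n c a IH [k0 _ xk0]]; first by rewrite /plug /= eqxx.
have H k : vars (a k) x ->
    depth x (a k) + height A < height (plug x (App c a) A).
  move=> xk; apply: leq_ltn_trans (IH k xk) _.
  exact: (height_arg c (fun k => plug x (a k) A)).
rewrite addnC -leq_subRL; last by have := H _ xk0; lia.
apply/bigmax_leqP => k /asboolP /H.
by rewrite -/(depth x (a k)); lia.
Qed.

Lemma depth_eq0 t : vars t x -> depth x t = 0 -> t = Var x.
Proof.
case: t => [i /= -> //|n c a [k _ xk]] /= d0.
by have := depth_arg c xk; rewrite /= d0.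
Qed.

Lemma height_iter_plug_le t A m :
  height (iter m (plug x t) A) <= m * depth x t + maxn (height t) (height A).
Proof.
elim: m => [|m IH] /=; first by lia.
by have := height_plug_le t (iter m (plug x t) A); lia.
Qed.

Lemma height_iter_plug_ge t A m : vars t x ->
  m * depth x t + height A <= height (iter m (plug x t) A).
Proof.
move=> xt; elim: m => [|m IH] //=.
by have := height_plug_ge (iter m (plug x t) A) xt; lia.
Qed.

Lemma plug_Var_eq u A B : height u < height A -> height A = height B ->
  A = plug x u B -> u = Var x.
Proof.
move=> uA AB E; have [xu|xu] := pselect (vars u x); last first.
  by move: uA; rewrite E plug_notin // ltnn.
by apply: depth_eq0 => //; have := height_plug_ge B xu; rewrite -E; lia.
Qed.

(** Being of smaller height, [t] and [u] cannot contain [A] or [B]; being of equal height, neither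
    of [A] and [B] properly contains the other. So the plugged positions agree. *)
Lemma plug_eq t u A B : height A = height B ->
  height t < height A -> height u < height A ->
  plug x t A = plug x u B -> t = u.
Proof.
move=> AB; elim: t u => [i|n c a IH] u tA uA E.
  have [ix|ix] := eqVneq i x.
    move: E; rewrite {1}/plug /= ix eqxx => E.
    by rewrite (plug_Var_eq uA AB E).
  case: u uA E => [j|m d b] uA; rewrite /plug /= (negPf ix) //.
  by case: eqP => // _ E; move: uA; rewrite AB -E.
case: u uA E => [j uA|m d b uA E].
  rewrite {2}/plug /=; case: eqP => // -> E.
  by apply: (plug_Var_eq (A := B) (B := A)) => //; rewrite -AB.
have nm : n = m by case: E.
subst m; have [-> ab] := App_inj E; congr App; apply: funext => k.
apply: IH; last exact: (congr1 (@^~ k) ab).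
- exact: leq_trans (height_arg c a k) (ltnW tA).
- exact: leq_trans (height_arg d b k) (ltnW uA).
Qed.

(* For [m] large, comparing heights yields [depth x t = depth x u]; the
   arguments of the outermost [t] and [u] then have the same large height, so
   that the occurrences of [x] in [t] and in [u] must coincide. *)
Lemma iter_plug_eq t u A B m : vars t x -> vars u x ->
  height t < m -> height u < m -> height A < m -> height B < m ->
  iter m.+1 (plug x t) A = iter m.+1 (plug x u) B -> t = u.
Proof.
move=> xt xu tm um Am Bm E.
have dtu : depth x t = depth x u.
  have := height_iter_plug_ge A m.+1 xt; have := height_iter_plug_le t A m.+1.
  have := height_iter_plug_ge B m.+1 xu; have := height_iter_plug_le u B m.+1.
  by rewrite E; nia.
have [d0|d_gt0] := posnP (depth x t).
  by rewrite (depth_eq0 xt d0) (depth_eq0 xu) // -dtu.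
(* One of the [m.+1] copies is peeled off for comparison; the [m] others, each of depth at least 1,
   make what it is applied to higher than [t] and [u]. *)
have hA := height_iter_plug_ge A m xt; have hB := height_iter_plug_ge B m xu.
rewrite -dtu in hB.
have md : m <= m * depth x t by nia.
move: E; rewrite !iterS => E.
have tA := height_plug_le t (iter m (plug x t) A).
have tA' := height_plug_ge (iter m (plug x t) A) xt.
have uB := height_plug_le u (iter m (plug x u) B).
have uB' := height_plug_ge (iter m (plug x u) B) xu.
by apply: plug_eq (E); move: tA tA' uB uB'; rewrite E -dtu; lia.
Qed.

Lemma iter_plug_inj t A B m : vars t x ->
  iter m (plug x t) A = iter m (plug x t) B -> A = B.
Proof. by move=> xt; elim: m => //= m IH /(plug_inj xt). Qed.

End Plug.

(** * Templates, traces and their naturality *)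

(* A tree of expected arities; [m] is the number of copies of the connective
   that [trace] stacks at the node. *)
Inductive template :=
| Leaf
| Node (n m : nat) (children : nat -> template).

Definition child (T : template) (k : nat) : template :=
  if T is Node _ _ T_ then T_ k else Leaf.

Definition at_path (T : template) (p : seq nat) : template := foldl child T p.

(* Traces use three disjoint families of variables: [slot k] pads the arguments
   of stacked connectives, [tag i p] stands for an occurrence of [Var i] at the
   path [p] of the traced formula, and [bad] for a mismatch with the template. *)
Definition code : Type := (nat + option (nat * seq nat))%type.
Definition slot (k : nat) : nat := pickle (inl k : code).
Definition tag (i : nat) (p : seq nat) : nat := pickle (inr (Some (i, p)) : code).
Definition bad : nat := pickle (inr None : code).

Lemma pickle_code_inj : injective (pickle : code -> nat).
Proof. exact: pcan_inj pickleK. Qed.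

Definition stack (S : signature) n (c : S n) (y : form S) : form S :=
  App c (fun k : 'I_n => if k == 0 :> nat then y else Var (slot k)).

Fixpoint trace (S : signature) (T : template) (p : seq nat) (phi : form S) :
    form S :=
  match phi with
  | Var i => Var (tag i p)
  | App n c a =>
      if T is Node n' m _ then
        if n' == n then
          iter m (stack c) (App c (fun k => trace (child T k) (rcons p k) (a k)))
        else Var bad
      else Var bad
  end.

(* At [tag i p] the reading of [s i] is resumed with the rest of the template. *)
Definition trace_subst (S : signature) (T : template) (s : nat -> form S) :
    nat -> form S :=
  fun v => if (unpickle v : option code) is Some (inr (Some (i, p)))
           then trace (at_path T p) p (s i) else Var v.

Lemma subst_stack (S : signature) T (s : nat -> form S) n (c : S n) m y :
  subst (trace_subst T s) (iter m (stack c) y) =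
  iter m (stack c) (subst (trace_subst T s) y).
Proof.
elim: m => //= m <-; congr App; apply: funext => k.
by case: eqP => // _; rewrite /= /trace_subst /slot pickleK.
Qed.

(** Makes [minus_entails] structural; the path [p] is general for the sake of the induction. *)
Lemma traceS (S : signature) T p (s : nat -> form S) (phi : form S) :
  trace (at_path T p) p (subst s phi) =
  subst (trace_subst T s) (trace (at_path T p) p phi).
Proof.
elim: phi p => [i|n c a IH] p /=; first by rewrite /trace_subst /tag pickleK.
have {}IH (k : 'I_n) : trace (child (at_path T p) k) (rcons p k) (subst s (a k)) =
    subst (trace_subst T s) (trace (child (at_path T p) k) (rcons p k) (a k)).
  by have := IH k (rcons p k); rewrite /at_path foldl_rcons.
have badE : Var bad = subst (trace_subst T s) (Var bad).
  by rewrite /= /trace_subst /bad pickleK.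
case: (at_path T p) IH => [|n' m T_] IH //.
case: eqP => // _; rewrite subst_stack /=.
by congr (iter m _ (App c _)); apply: funext => k.
Qed.

(** Strict morphisms keep arities, and a template tests nothing else. *)
Lemma hat_trace (S S' : signature) (f : strict S S') T p (phi : form S) :
  hat f (trace T p phi) = trace T p (hat f phi).
Proof.
elim: phi T p => //= n c a IH [|n' m T_] p //.
case: eqP => // _.
have -> : App (f n c) (fun k : 'I_n => trace (T_ k) (rcons p k) (hat f (a k))) =
    hat f (App c (fun k : 'I_n => trace (T_ k) (rcons p k) (a k))).
  by congr App; apply: funext => k.
elim: m => //= m <-; congr App; apply: funext => k.
by case: eqP.
Qed.

(** * Separation of formulas by expanded traces *)

(* The map [y |-> t(y, slot 1, ..., slot (n-1))] that [check eval] makes of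
   [stack t] is plugging in [slot 0] of [spine t]. *)
Definition spine (S : signature) n (t : terms S n) : form S :=
  subst (fill (fun k : 'I_n => Var (slot k))) (sval t).

Definition expand (S : signature) (T : template) p (phi : form (terms S)) :
  form S := check (@eval S) (trace T p phi).

Section Spine.
Variables (S : signature) (n : nat).
Implicit Types t u : terms S n.

Lemma plug_spine t A :
  plug (slot 0) (spine t) A =
  subst (fill (fun k : 'I_n => if k == 0 :> nat then A else Var (slot k)))
    (sval t).
Proof.
rewrite /plug /spine subst_fill; congr (subst (fill _) _).
apply: funext => k /=; congr (if _ then _ else _).
by apply/eqP/eqP => [/pickle_code_inj[] //|->].
Qed.

Lemma check_stack t m (y : form (terms S)) :
  check (@eval S) (iter m (stack t) y) =
  iter m (plug (slot 0) (spine t)) (check (@eval S) y).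
Proof.
elim: m => //= m <-; rewrite plug_spine; congr (subst (fill _) _).
by apply: funext => k; case: eqP.
Qed.

Lemma spine_inj t u : spine t = spine u -> t = u.
Proof.
move=> tu; apply: terms_inj.
pose unslot i : form S :=
  if (unpickle i : option code) is Some (inl k) then Var k else Var i.
have spineK (v : terms S n) : subst unslot (spine v) = sval v.
  rewrite subst_fill -[RHS]subst_Var; apply: eq_subst => i.
  rewrite inE (svalP v) /= => lin.
  by rewrite -[i]/(val (Ordinal lin)) fill_ord /= /unslot /slot pickleK.
by rewrite -(spineK t) tu spineK.
Qed.

Lemma vars_spine t : 0 < n -> vars (spine t) (slot 0).
Proof. by move=> n_gt0; rewrite vars_fill; exists (Ordinal n_gt0). Qed.

(** Each of the first [n] variables does occur in [t]. *)
Lemma fill_inj t (a b : 'I_n -> form S) :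
  subst (fill a) (sval t) = subst (fill b) (sval t) -> a = b.
Proof.
move=> /subst_inj tab; apply: funext => k.
by have := tab k; rewrite (svalP t) !fill_ord; apply; exact: ltn_ord.
Qed.

End Spine.

Lemma vars_stack (S : signature) n (c : S n) m y x :
  vars (iter m (stack c) y) x -> vars y x \/ exists k, x = slot k.
Proof.
elim: m => [|m IH] /=; first by left.
by move=> [k _]; case: eqP => [_ /IH //|_ /= ->]; right; exists k.
Qed.

Lemma trace_tag (S : signature) T p (phi : form S) i q :
  vars (trace T p phi) (tag i q) -> size p <= size q.
Proof.
elim: phi T p => [j|n c a IH] T p /=; first by move=> /pickle_code_inj[_ ->].
case: T => [|n' m T_] /=; first by move=> /pickle_code_inj.
case: eqP => [_|_]; last by move=> /pickle_code_inj.
move=> H; have [[k _ kq]|[k]] := vars_stack H; last by move=> /pickle_code_inj.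
by apply: ltnW; have := IH _ _ _ kq; rewrite size_rcons.
Qed.

(** Excludes [tag j p], the trace at [p] of the variable [j]. *)
Lemma trace_App_tag (S : signature) T p n (c : S n) a i q :
  vars (trace T p (App c a)) (tag i q) -> size p < size q.
Proof.
case: T => [|n' m T_] /=; first by move=> /pickle_code_inj.
case: eqP => [_|_]; last by move=> /pickle_code_inj.
move=> H; have [[k _ kq]|[k]] := vars_stack H; last by move=> /pickle_code_inj.
by have := trace_tag kq; rewrite size_rcons.
Qed.

Lemma finite_bounded (T : Type) (D : set T) (f : T -> nat) :
  finite_set D -> exists m, forall x, D x -> f x < m.
Proof.
move=> /(finite_image f)/finite_seqP[s sE].
exists (\max_(i <- s) i).+1 => x Dx; rewrite ltnS.
have : f x \in s by have : (f @` D) (f x) by [exists x]; rewrite sE.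
by move=> /leq_bigmax_seq; exact.
Qed.

Lemma Var_inj (S : signature) (i j : nat) :
  Var i = Var j :> form S -> i = j.
Proof. by case. Qed.

Definition arg (S : signature) (k : nat) (phi : form S) : form S :=
  if phi is App n _ a then oapp a phi (insub k) else phi.

Lemma arg_App (S : signature) n (c : S n) a (k : 'I_n) : arg k (App c a) = a k.
Proof. by rewrite /arg valK. Qed.

(* The template follows the shape of [phi]; a [delta] of another shape yields
   [bad] or a [tag] absent from the trace of [phi].  Otherwise the multiplicity
   at each node exceeds all heights in sight, so that [iter_plug_eq] recovers
   the connective at the root and induction recovers its arguments. *)
Lemma separation (S : signature) (phi : form (terms S)) p D : finite_set D ->
  exists T, ~ vars (trace T p phi) bad /\
    forall delta, D delta -> expand T p delta = expand T p phi -> delta = phi.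
Proof.
elim: phi p D => [i|n t a IH] p D Dfin.
  exists Leaf; split=> [badE|delta _].
    by have /pickle_code_inj := badE : bad = tag i p.
  case: delta => [j|n t a]; rewrite /expand /= => /Var_inj/pickle_code_inj //.
  by move=> [->].
have /choice[T_ TP] := fun k : 'I_n =>
  IH k (rcons p k) _ (finite_image (arg k) Dfin).
pose T' (k : nat) := oapp T_ Leaf (insub k).
have T'E (k : 'I_n) : T' k = T_ k by rewrite /T' valK.
pose base d (u : terms S d) b :=
  check (@eval S) (App u (fun k : 'I_d => trace (T' k) (rcons p k) (b k))).
(* The two heights that [iter_plug_eq] compares with [m]. The templates of the arguments are already
   fixed, so [base] does not depend on [m]. *)
pose h delta := if delta is App d u b
  then maxn (height (spine u)) (height (base d u b)) else 0.
have [m mP] : exists m, forall x, (D `|` [set App t a]) x -> h x < m.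
  by apply: finite_bounded; rewrite finite_setU; split=> //; exact: finite_set1.
(* Nullary connectives have no slot to stack on. *)
pose M := if n is 0 then 0 else m.+1.
have bad_notin : ~ vars (trace (Node n M T') p (App t a)) bad.
  rewrite /= eqxx => H.
  have [[k _ kbad]|[k]] := vars_stack H; last by move=> /pickle_code_inj.
  by apply: (proj1 (TP k)); rewrite -T'E.
exists (Node n M T'); split=> // delta Dd E.
(* [check] preserves variables, so equal expansions come from traces with the same tags and the same
   occurrence of [bad]. *)
have varsE : vars (trace (Node n M T') p delta) =
    vars (trace (Node n M T') p (App t a)).
  by rewrite -!(vars_check (@eval S)) -/(expand _ _ _) E.
case: delta Dd E varsE => [j|d u b] Dd E varsE.
  have : vars (trace (Node n M T') p (App t a)) (tag j p) by rewrite -varsE.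
  by move=> jp; have := trace_App_tag jp; rewrite ltnn.
have [nd|nd] := eqVneq n d; last first.
  by case: bad_notin; rewrite -varsE /= (negPf nd).
subst d.
have {E} : iter M (plug (slot 0) (spine u)) (base n u b) =
    iter M (plug (slot 0) (spine t)) (base n t a).
  by move: E; rewrite /expand /= eqxx !check_stack.
have ut : iter M (plug (slot 0) (spine u)) (base n u b) =
    iter M (plug (slot 0) (spine t)) (base n t a) -> u = t.
  have [n0|n_gt0] := posnP n.
    subst n; rewrite /M /= /base /= => E; apply: terms_inj.
    have closed (v : terms S 0) s : subst s (sval v) = sval v.
      rewrite -[RHS]subst_Var; apply: eq_subst => i.
      by rewrite inE (svalP v).
    by rewrite !closed in E.
  have -> : M = m.+1 by rewrite /M; case: (n) n_gt0.
  have := mP _ (or_introl Dd); have := mP _ (or_intror erefl).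
  rewrite /h !gtn_max => /andP[tm am] /andP[um bm].
  have ux := vars_spine u n_gt0; have tx := vars_spine t n_gt0.
  by move=> /iter_plug_eq => /(_ ux tx um tm bm am)/spine_inj.
move=> E; have := ut E => ?; subst u; congr App; apply: funext => k.
have : base n t b = base n t a.
  have [n0|n_gt0] := posnP n; last exact: iter_plug_inj (vars_spine t n_gt0) E.
  by subst n.
move=> /fill_inj/(congr1 (@^~ k)) /=; rewrite T'E.
apply: (proj2 (TP k)); exists (App t b) => //.
exact: arg_App.
Qed.

(** * The consequence relations of the two lifted functors *)

Lemma Cons_subst (S : signature) (c : conseq S) (s : nat -> form S) G phi :
  Cons c G phi -> Cons c (subst s @` G) (subst s phi).
Proof. by move=> Gphi; apply: Cons_structural; exists phi. Qed.

Section PlusConseq.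
Variables (S : signature) (c : conseq S).

(** The substitution [s] in the rule yields structurality, the finiteness of [D] finitarity. *)
Inductive plus_deriv (G : set (form S)) : form S -> Prop :=
| plus_ax phi : G phi -> plus_deriv G phi
| plus_rule T s D phi : finite_set D -> Cons c D phi ->
    (forall psi, D psi -> plus_deriv G (subst s (trace T [::] psi))) ->
    plus_deriv G (subst s (trace T [::] phi)).

Fact plus_mono (G D : set (form S)) :
  G `<=` D -> plus_deriv G `<=` plus_deriv D.
Proof.
move=> GD phi; elim=> {phi} [phi /GD|T s E phi Efin Ephi _ IH].
  exact: plus_ax.
exact: plus_rule Efin Ephi IH.
Qed.

Fact plus_idem (G : set (form S)) :
  plus_deriv (plus_deriv G) `<=` plus_deriv G.
Proof.
move=> phi; elim=> {phi} [//|T s E phi Efin Ephi _ IH].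
exact: plus_rule Efin Ephi IH.
Qed.

Fact plus_finitary (G : set (form S)) phi : plus_deriv G phi ->
  exists D, [/\ finite_set D, D `<=` G & plus_deriv D phi].
Proof.
elim=> {phi} [phi Gphi|T s E phi Efin Ephi _ IH].
  exists [set phi]; split; [exact: finite_set1|by move=> _ ->|exact: plus_ax].
have /choice[D_ DP] : forall psi, exists D, E psi -> [/\ finite_set D, D `<=` G &
    plus_deriv D (subst s (trace T [::] psi))].
  move=> psi; have [/IH[D DP]|nE] := pselect (E psi); first by exists D.
  by exists set0.
exists (\bigcup_(psi in E) D_ psi); split.
- by apply: bigcup_finite => // psi /DP[].
- by move=> chi [psi /DP[_ + _]]; apply.
apply: plus_rule Efin Ephi _ => psi Epsi; have [_ _] := DP psi Epsi.
by apply: plus_mono => chi Dchi; exists psi.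
Qed.

Fact plus_structural (s : nat -> form S) (G : set (form S)) :
  subst s @` plus_deriv G `<=` plus_deriv (subst s @` G).
Proof.
move=> _ [phi + <-]; elim=> {phi} [phi Gphi|T t E phi Efin Ephi _ IH].
  by apply: plus_ax; exists phi.
rewrite subst_subst; apply: plus_rule Efin Ephi _ => psi /IH.
by rewrite subst_subst.
Qed.

Definition plus_conseq : conseq S :=
  Conseq (@plus_ax) plus_mono plus_idem plus_finitary plus_structural.

End PlusConseq.

Section MinusConseq.
Variables (S : signature) (c : conseq S).

(** One [D] serves all templates, so a template may later be chosen to separate [phi] from [D]. *)
Definition minus_entails (G : set (form (terms S))) (phi : form (terms S)) :=
  exists D, [/\ finite_set D, D `<=` G &
    forall T, Cons c (expand T [::] @` D) (expand T [::] phi)].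

Fact minus_ext G : G `<=` minus_entails G.
Proof.
move=> phi Gphi; exists [set phi]; split; first exact: finite_set1.
  by move=> _ ->.
by move=> T; apply: Cons_ext; exists phi.
Qed.

Fact minus_mono (G D : set (form (terms S))) :
  G `<=` D -> minus_entails G `<=` minus_entails D.
Proof.
move=> GD phi [E [Efin EG Ephi]]; exists E; split=> //.
exact: subset_trans GD.
Qed.

Fact minus_idem G : minus_entails (minus_entails G) `<=` minus_entails G.
Proof.
move=> phi [E [Efin EG Ephi]].
have /choice[D_ DP] : forall psi, exists D, E psi -> [/\ finite_set D, D `<=` G &
    forall T, Cons c (expand T [::] @` D) (expand T [::] psi)].
  move=> psi; have [/EG[D DP]|nE] := pselect (E psi); first by exists D.
  by exists set0.
exists (\bigcup_(psi in E) D_ psi); split.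
- by apply: bigcup_finite => // psi /DP[].
- by move=> chi [psi /DP[_ + _]]; apply.
move=> T; apply: Cons_idem; move: (Ephi T); apply: Cons_mono.
move=> _ [psi Epsi <-]; have [_ _ /(_ T)] := DP psi Epsi.
by apply: Cons_mono; apply: image_subset => chi Dchi; exists psi.
Qed.

Fact minus_finitary G phi : minus_entails G phi ->
  exists D, [/\ finite_set D, D `<=` G & minus_entails D phi].
Proof. by move=> [D [Dfin DG Dphi]]; exists D; split=> //; exists D; split. Qed.

Fact minus_structural (s : nat -> form (terms S)) G :
  subst s @` minus_entails G `<=` minus_entails (subst s @` G).
Proof.
move=> _ [phi [D [Dfin DG Dphi]] <-]; exists (subst s @` D); split.
- exact: finite_image.
- exact: image_subset.
move=> T; pose s' i := check (@eval S) (trace_subst T s i).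
have expandS psi : expand T [::] (subst s psi) = subst s' (expand T [::] psi).
  by rewrite /expand -[T]/(at_path T [::]) traceS check_subst.
rewrite expandS image_comp.
have -> : (expand T [::] \o subst s) @` D = subst s' @` (expand T [::] @` D).
  by rewrite image_comp; apply: eq_imagel => psi _; exact: expandS.
exact: Cons_subst.
Qed.

Definition minus_conseq : conseq (terms S) :=
  Conseq minus_ext minus_mono minus_idem minus_finitary minus_structural.

End MinusConseq.

(** * Preservation of consequence and the logic adjunction *)

Lemma plus_preserves (l l' : logic) (f : Ls_hom l l') :
  @preserves (Logic (plus_conseq (conseq_of l)))
    (Logic (plus_conseq (conseq_of l'))) (check (plus_map (sval f))).
Proof.
move=> G psi /=; have -> : check (plus_map (sval f)) = hat (sval f).
  by apply: funext => phi; exact: check_generic.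
have hat_subst s phi : hat (sval f) (subst s phi) =
    subst (fun i => hat (sval f) (s i)) (hat (sval f) phi).
  by elim: phi => //= n c a IH; congr App; apply: funext.
elim=> {psi} [phi Gphi|T s D phi Dfin Dphi _ IH].
  by apply: plus_ax; exists phi.
rewrite hat_subst hat_trace; apply: plus_rule (finite_image _ Dfin) _ _.
  exact: (svalP f).
by move=> _ [psi /IH + <-]; rewrite hat_subst hat_trace.
Qed.

Lemma check_hat (S S' S'' : signature) (g : flexible S' S'') (f : strict S S')
    phi : check g (hat f phi) = check (fun n c => g n (f n c)) phi.
Proof.
elim: phi => //= n c a IH; congr (subst (fill _) _); exact: funext.
Qed.

Lemma minus_preserves (l l' : logic) (f : Lf_hom l l') :
  @preserves (Logic (minus_conseq (conseq_of l)))
    (Logic (minus_conseq (conseq_of l'))) (hat (check_restr (sval f))).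
Proof.
move=> G psi [D [Dfin DG Dpsi]].
exists (hat (check_restr (sval f)) @` D); split.
- exact: finite_image.
- exact: image_subset.
move=> T; have expandE phi : expand T [::] (hat (check_restr (sval f)) phi) =
    check (sval f) (expand T [::] phi).
  by rewrite /expand -hat_trace check_hat -check_comp.
rewrite expandE image_comp.
have -> : (expand T [::] \o hat (check_restr (sval f))) @` D =
    check (sval f) @` (expand T [::] @` D).
  by rewrite image_comp; apply: eq_imagel => phi _; exact: expandE.
exact: (svalP f).
Qed.

(** Since [eval] undoes [generic], the expansion of an embedded formula is its trace, and one use of
    [plus_rule] suffices. *)
Lemma unit_preserves (l : logic) :
  @preserves l (Logic (minus_conseq (plus_conseq (conseq_of l))))
    (hat (@generic (sig_of l))).
Proof.
move=> G psi /Cons_finitary[D [Dfin DG Dpsi]].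
exists (hat (@generic (sig_of l)) @` D); split.
- exact: finite_image.
- exact: image_subset.
move=> T.
have expandE phi :
    expand T [::] (hat (@generic (sig_of l)) phi) = trace T [::] phi.
  by rewrite /expand -hat_trace check_hat check_id.
rewrite expandE -[trace _ _ _]subst_Var.
apply: plus_rule Dfin Dpsi _ => chi Dchi; rewrite subst_Var.
by apply: plus_ax; exists (hat (@generic (sig_of l)) chi).
Qed.

(** [check eval] turns a rule for [T] into a substitution instance of the clause of [minus_entails]
    for [T]. *)
Lemma counit_preserves (l : logic) :
  @preserves (Logic (plus_conseq (minus_conseq (conseq_of l)))) l
    (check (@eval (sig_of l))).
Proof.
move=> G psi; elim=> {psi} [phi Gphi|T s E phi Efin [D [Dfin DE Dphi]] _ IH].
  by apply: Cons_ext; exists phi.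
apply: Cons_idem; rewrite check_subst.
move: (Cons_subst (fun i => check (@eval _) (s i)) (Dphi T)).
apply: Cons_mono => _ [_ [chi /DE/IH + <-] <-].
by rewrite check_subst.
Qed.

Definition plus_L : functor Ls Lf.
Proof.
apply: (@Functor Ls Lf (fun l => Logic (plus_conseq (conseq_of l)))
  (fun l l' f => exist _ (plus_map (sval f)) (plus_preserves f))).
- by move=> l; exact: eq_exist.
- by move=> l l' l'' g f; apply: eq_exist; exact: plus_map_comp.
Defined.

Definition minus_L : functor Lf Ls.
Proof.
apply: (@Functor Lf Ls (fun l => Logic (minus_conseq (conseq_of l)))
  (fun l l' f => exist _ (check_restr (sval f)) (minus_preserves f))).
- by move=> l; apply: eq_exist; exact: check_restr_id.
- by move=> l l' l'' g f; apply: eq_exist; exact: check_restr_comp.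
Defined.

Definition eta_L : nattrans (functor_id Ls) (minus_L \oF plus_L).
Proof.
apply: (@NatTrans Ls Ls (functor_id Ls) (minus_L \oF plus_L)
  (fun l => exist _ (@generic (sig_of l)) (@unit_preserves l))).
by move=> l l' f; apply: eq_exist; exact: eta_S_natural.
Defined.

Definition eps_L : nattrans (plus_L \oF minus_L) (functor_id Lf).
Proof.
apply: (@NatTrans Lf Lf (plus_L \oF minus_L) (functor_id Lf)
  (fun l => exist _ (@eval (sig_of l)) (@counit_preserves l))).
by move=> l l' f; apply: eq_exist; exact: eps_S_natural.
Defined.

Definition adj_L : adjunction Ls Lf.
Proof.
apply: (@Adjunction Ls Lf plus_L minus_L eta_L eps_L).
- by move=> l; apply: eq_exist; exact: sig_triangle_left.
- by move=> l; apply: eq_exist; exact: sig_triangle_right.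
Defined.

(** * Least and greatest relations, and equality of functors *)

Lemma conseq_eq (S : signature) (c d : conseq S) :
  (forall G phi, Cons c G phi <-> Cons d G phi) -> c = d.
Proof.
case: c d => [C c1 c2 c3 c4 c5] [D d1 d2 d3 d4 d5] /= CD.
have E : C = D by apply: funext => G; apply/predeqP => phi; exact: CD.
by subst D; congr Conseq; exact: Prop_irrelevance.
Qed.

Lemma plus_bot (S : signature) : plus_conseq (conseq_bot S) = conseq_bot S.
Proof.
apply: conseq_eq => G phi; split; last exact: plus_ax.
by elim=> {phi} [//|T s D phi _ Dphi _]; exact.
Qed.

Lemma plus_top (S : signature) : plus_conseq (conseq_top S) = conseq_top S.
Proof.
apply: conseq_eq => G phi; split=> // _.
(* The trace of a variable is a variable, which the constant substitution sends to [phi]. *)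
have := @plus_rule S (conseq_top S) G Leaf (fun=> phi) set0 (Var 0).
by apply=> //; exact: finite_set0.
Qed.

Lemma minus_bot (S : signature) :
  minus_conseq (conseq_bot S) = conseq_bot (terms S).
Proof.
apply: conseq_eq => G phi; split; last exact: minus_ext.
move=> [D [Dfin DG Dphi]]; have [T [_ TP]] := separation phi [::] Dfin.
have [psi Dpsi /(TP _ Dpsi) <-] := Dphi T.
exact: DG.
Qed.

(** With [c] and [d] variables, their equality can be eliminated; then only proofs differ. *)
Lemma functor_Lf_eq (C : category) (o : C -> signature)
    (m : forall x y, hom x y -> flexible (o x) (o y))
    (c d : forall x, conseq (o x)) (cP : forall x y (f : hom x y),
      @preserves (Logic (c x)) (Logic (c y)) (check (m x y f)))
    (dP : forall x y (f : hom x y),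
      @preserves (Logic (d x)) (Logic (d y)) (check (m x y f)))
    c1 c2 d1 d2 :
  (forall x, c x = d x) ->
  @Functor C Lf (fun x => Logic (c x)) (fun x y f => exist _ (m x y f) (cP x y f))
    c1 c2 =
  @Functor C Lf (fun x => Logic (d x)) (fun x y f => exist _ (m x y f) (dP x y f))
    d1 d2.
Proof.
move=> cd; have {cd}E : c = d by exact: functional_extensionality_dep.
subst d; have E : cP = dP by exact: Prop_irrelevance.
by subst dP; congr Functor; exact: Prop_irrelevance.
Qed.

Lemma functor_Ls_eq (C : category) (o : C -> signature)
    (m : forall x y, hom x y -> strict (o x) (o y))
    (c d : forall x, conseq (o x)) (cP : forall x y (f : hom x y),
      @preserves (Logic (c x)) (Logic (c y)) (hat (m x y f)))
    (dP : forall x y (f : hom x y),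
      @preserves (Logic (d x)) (Logic (d y)) (hat (m x y f)))
    c1 c2 d1 d2 :
  (forall x, c x = d x) ->
  @Functor C Ls (fun x => Logic (c x)) (fun x y f => exist _ (m x y f) (cP x y f))
    c1 c2 =
  @Functor C Ls (fun x => Logic (d x)) (fun x y f => exist _ (m x y f) (dP x y f))
    d1 d2.
Proof.
move=> cd; have {cd}E : c = d by exact: functional_extensionality_dep.
subst d; have E : cP = dP by exact: Prop_irrelevance.
by subst dP; congr Functor; exact: Prop_irrelevance.
Qed.

Theorem theorem2p14 :
  exists adj_L : adjunction Ls Lf,
    (U_f \oF adj_left adj_L = adj_left adj_S \oF U_s) /\
    (U_s \oF adj_right adj_L = adj_right adj_S \oF U_f) /\
    (forall l : Ls,
       arrow (fmap U_s (adj_unit adj_L l)) = arrow (adj_unit adj_S (U_s l))) /\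
    (forall l : Lf,
       arrow (fmap U_f (adj_counit adj_L l)) =
       arrow (adj_counit adj_S (U_f l))) /\
    (adj_left adj_L \oF bot_s = bot_f \oF adj_left adj_S) /\
    (adj_left adj_L \oF top_s = top_f \oF adj_left adj_S) /\
    (adj_right adj_L \oF bot_f = bot_s \oF adj_right adj_S) /\
    (forall S : Sf,
       logic_le ((adj_right adj_L \oF top_f) S)
         ((top_s \oF adj_right adj_S) S)).
Proof.
exists adj_L; split; first by congr Functor; exact: Prop_irrelevance.
split; first by congr Functor; exact: Prop_irrelevance.
(* (3) and (4) hold by conversion: the morphisms underlying [eta_L] and [eps_L] are [generic] and
   [eval]. *)
do 2![split=> //].
split; first by apply: functor_Lf_eq => S; exact: plus_bot.
split; first by apply: functor_Lf_eq => S; exact: plus_top.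
split; first by apply: functor_Ls_eq => S; exact: minus_bot.
by move=> S; apply: LogicLe; exact: conseq_topP.
Qed.
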